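(* Let $(S,\cdot,\ast)$ be a regular $\star$-semigroup. Define binary operations $+$ and $\oplus$ on $S$ by $a+b=ab^\ast$ and $a\oplus b=ba^\ast$ for all $a,b\in S$. Then the map associated to $(S,+,\cdot,\ast)$ is a solution of the Yang-Baxter equation if and only if $(S,\cdot,\ast)$ is completely regular, orthodox and locally inverse. Likewise, the map associated to $(S,\oplus,\cdot,\ast)$ is a solution of the Yang-Baxter equation if and only if $(S,\cdot,\ast)$ is completely regular, orthodox and locally inverse.
   Context: A regular $\star$-semigroup is a triple $(S,\cdot,\ast)$ where $(S,\cdot)$ is a semigroup on a non-empty set and $\ast:S\to S$, $x\mapsto x^\ast$, satisfies $xx^\ast x=x$, $(x^\ast)^\ast=x$, $(xy)^\ast=y^\ast x^\ast$ for all $x,y\in S$. It is called completely regular if $a\,\mathcal H\,a^2$ for all $a\in S$ ($\mathcal H=\mathcal L\cap\mathcal R$ being Green's relation), orthodox if the product of any two idempotents is idempotent, and locally inverse if $eSe$ is an inverse semigroup for every idempotent $e$. For a set $S$ with binary operations $+,\cdot$ ($+$ not necessarily associative) and a unary operation $\ast$, the map associated to $(S,+,\cdot,\ast)$ is $r_S:S\times S\to S\times S$, $r_S(a,b)=(a(a^{\ast}+b),\,(a^{\ast}+b)^{\ast}b)$; similarly with $\oplus$ in place of $+$. A map $r:S\times S\to S\times S$ is a (set-theoretic) solution of the Yang-Baxter equation if $(r\times \mathrm{id}_S)(\mathrm{id}_S\times r)(r\times \mathrm{id}_S)=(\mathrm{id}_S\times r)(r\times \mathrm{id}_S)(\mathrm{id}_S\times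 r)$ as maps $S^3\to S^3$. *)

(* Defs.v *)
From mathcomp Require Import all_boot.

Set Implicit Arguments.
Unset Strict Implicit.
Unset Printing Implicit Defensive.

(* The operations are explicit parameters over a bare Type: MathComp's
   semigroupType would in addition equip the carrier with a choice structure
   (hence with decidable equality). *)

Record regular_star_semigroup (S : Type) (mul : S -> S -> S) (star : S -> S)
    : Prop := RegularStarSemigroup {
  rss_inhabited : inhabited S;
  rss_mulA : associative mul;
  rss_mul_star_mul : forall x, mul (mul x (star x)) x = x;
  rss_starK : involutive star;
  rss_starM : {morph star : x y / mul x y >-> mul y x}
}.

Definition idempotent_elt (S : Type) (mul : S -> S -> S) (e : S) : Prop :=
  mul e e = e.

(* S^1 a and a S^1, where S^1 is S with an identity adjoined if necessary. *)
Definition left_principal_ideal (S : Type) (mul : S -> S -> S) (a x : S)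
    : Prop := x = a \/ exists s, x = mul s a.

Definition right_principal_ideal (S : Type) (mul : S -> S -> S) (a x : S)
    : Prop := x = a \/ exists s, x = mul a s.

Definition green_L (S : Type) (mul : S -> S -> S) (a b : S) : Prop :=
  forall x, left_principal_ideal mul a x <-> left_principal_ideal mul b x.

Definition green_R (S : Type) (mul : S -> S -> S) (a b : S) : Prop :=
  forall x, right_principal_ideal mul a x <-> right_principal_ideal mul b x.

Definition green_H (S : Type) (mul : S -> S -> S) (a b : S) : Prop :=
  green_L mul a b /\ green_R mul a b.

Definition completely_regular (S : Type) (mul : S -> S -> S) : Prop :=
  forall a, green_H mul a (mul a a).

Definition orthodox (S : Type) (mul : S -> S -> S) : Prop :=
  forall e f, idempotent_elt mul e -> idempotent_elt mul f ->
    idempotent_elt mul (mul e f).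

(* The subset A is an inverse semigroup under the restriction of mul; the
   inverse is required to exist, and to be unique, within A. *)
Definition inverse_subsemigroup (S : Type) (mul : S -> S -> S) (A : S -> Prop)
    : Prop :=
  (forall x y, A x -> A y -> A (mul x y)) /\
  (forall x, A x -> exists! y,
     A y /\ mul (mul x y) x = x /\ mul (mul y x) y = y).

(* e S e *)
Definition local_subsemigroup (S : Type) (mul : S -> S -> S) (e x : S) : Prop :=
  exists s, x = mul (mul e s) e.

Definition locally_inverse (S : Type) (mul : S -> S -> S) : Prop :=
  forall e, idempotent_elt mul e ->
    inverse_subsemigroup mul (local_subsemigroup mul e).

Definition associated_map (S : Type) (add mul : S -> S -> S) (star : S -> S)
    (p : S * S) : S * S :=
  let: (a, b) := p in
  (mul a (add (star a) b), mul (star (add (star a) b)) b).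

(* S^3 is represented as (S * S) * S. *)
Definition map_times_id (S : Type) (r : S * S -> S * S) (t : S * S * S)
    : S * S * S :=
  let: (x, y, z) := t in let: (x', y') := r (x, y) in (x', y', z).

Definition id_times_map (S : Type) (r : S * S -> S * S) (t : S * S * S)
    : S * S * S :=
  let: (x, y, z) := t in let: (y', z') := r (y, z) in (x, y', z').

Definition yang_baxter_solution (S : Type) (r : S * S -> S * S) : Prop :=
  map_times_id r \o id_times_map r \o map_times_id r
    =1 id_times_map r \o map_times_id r \o id_times_map r.

Definition star_plus (S : Type) (mul : S -> S -> S) (star : S -> S) (a b : S)
    : S := mul a (star b).

Definition star_oplus (S : Type) (mul : S -> S -> S) (star : S -> S) (a b : S)
    : S := mul b (star a).

(* Main.v *)
Require Import Defs.
From mathcomp Require Import all_boot.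

(** Let [e] and [f] be projections, i.e. self-adjoint idempotents.  At [(e, f, z)]
    the first component of the Yang-Baxter equation for [+] says that [e f] is a
    two-sided identity for [e z f]; this makes idempotents commute locally.  The third component gives
    [e f x f e = e f e x f e], hence orthodoxy, and the first one at
    [(x, x, e)], [e = x x^*], gives complete regularity.

    Conversely, in a completely regular, orthodox, locally inverse semigroup an
    idempotent [i] can be erased from [u i v] as soon as [u v] lies in the ideal
    [S i S]; all three components of the equation follow by erasing and
    inserting projections.

    The map associated to the second operation is, up to swapping coordinates,
    the one associated to [+] in the opposite semigroup. *)

Section RegularStarSemigroup.

Variables (S : Type) (mul : S -> S -> S) (star : S -> S).
Hypothesis hS : regular_star_semigroup mul star.

Local Notation "x * y" := (mul x y).
Local Notation "x ^*" := (star x).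
Local Notation idem := (idempotent_elt mul).

Let mulA : associative mul := rss_mulA hS.
Let mulxVx x : x * x^* * x = x := rss_mul_star_mul hS x.
Let starK : involutive star := rss_starK hS.
Let starM x y : (x * y)^* = y^* * x^* := rss_starM hS x y.

Lemma mulVxV x : x^* * x * x^* = x^*.
Proof. by rewrite -{2}(starK x) mulxVx. Qed.

Lemma idem_mulxV x : idem (x * x^*).
Proof. by rewrite /idempotent_elt mulA mulxVx. Qed.

Lemma idem_mulVx x : idem (x^* * x).
Proof. by rewrite /idempotent_elt mulA mulVxV. Qed.

Lemma star_idem e : idem e -> idem e^*.
Proof. by move=> ee; rewrite /idempotent_elt -starM ee. Qed.

Arguments star_idem {e} _.

(** * The associated map of [+] in components *)

Lemma plus_mapE a b :
  associated_map (star_plus mul star) mul star (a, b)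
    = (a * a^* * b^*, b * a * b).
Proof. by rewrite /= /star_plus starM !starK mulA. Qed.

(** [ybe1], [ybe2] and [ybe3] equate the three coordinates of both sides at [(x, y, z)], with the
    stars pushed inwards. *)
Definition ybe1 x y z :=
  x * x^* * (y^* * y) * (x * x^*) * z * ((y * x * y) * (y * x * y)^*)
    = x * x^* * z * (y * y^*).

Definition ybe2 x y z :=
  let q := y * x * y * (y * x * y)^* in
  let p := y * y^* * z^* * x * (y * y^* * z^*) in
  q * z^* * (x * x^*) * y^* * q * z^* = p * p^* * (z^* * y^* * z^*).

Definition ybe3 x y z :=
  z * y * x * y * z
    = z * y * ((z * y) * (z * y)^*) * x * (y * y^*) * (z^* * z) * (y * z).

Lemma yang_baxter_plusE :
  yang_baxter_solution (associated_map (star_plus mul star) mul star) <->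
  forall x y z, [/\ ybe1 x y z, ybe2 x y z & ybe3 x y z].
Proof.
move: (associated_map _ _ _) plus_mapE => r rE.
have E x y z :
    (map_times_id r \o id_times_map r \o map_times_id r) (x, y, z)
      = (id_times_map r \o map_times_id r \o id_times_map r) (x, y, z)
    <-> [/\ ybe1 x y z, ybe2 x y z & ybe3 x y z].
  do 4 rewrite /= ?rE.
  rewrite /ybe1 /ybe2 /ybe3 !(starM, starK, mulA).
  by split=> [[-> -> ->] | [-> -> ->]].
split=> [Y x y z | Y [[x y] z]]; first exact/E/Y.
exact/E/Y.
Qed.

(* Identities multiplied by a prefix, so that they apply inside the
   left-associated words produced by [!mulA]. *)
Lemma mul2_prefix a b c : a * b = c -> forall u, u * a * b = u * c.
Proof. by move=> <- u; rewrite mulA. Qed.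

Lemma mul3_prefix a b c d : a * b * c = d -> forall u, u * a * b * c = u * d.
Proof. by move=> <- u; rewrite !mulA. Qed.

Lemma mul4_prefix a b c d e :
  a * b * c * d = e -> forall u, u * a * b * c * d = u * e.
Proof. by move=> <- u; rewrite !mulA. Qed.

Arguments mul2_prefix {a b c} _ u.
Arguments mul3_prefix {a b c d} _ u.
Arguments mul4_prefix {a b c d e} _ u.

Lemma mul_idemr u e : idem e -> u * e * e = u * e.
Proof. by move/mul2_prefix. Qed.

Arguments mul_idemr {u e} _.

(** * Local submonoids and their idempotents *)

Lemma local_subsemigroupE e x :
  idem e -> local_subsemigroup mul e x <-> e * x = x /\ x * e = x.
Proof.
move=> ee; split=> [[s ->] | [ex xe]]; last by exists x; rewrite ex xe.
by rewrite (mul_idemr ee) !mulA ee.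
Qed.

Arguments local_subsemigroupE {e x} _.

Definition locally_commuting :=
  forall i g h, idem i -> idem g -> idem h ->
    i * g = g -> g * i = g -> i * h = h -> h * i = h -> g * h = h * g.

Lemma locally_inverse_commuting : locally_commuting -> locally_inverse mul.
Proof.
move=> C e ee; split=> [x y | x] /(local_subsemigroupE ee).
  case=> ex xe /(local_subsemigroupE ee) [ey ye].
  by apply/local_subsemigroupE => //; rewrite mulA ex -mulA ye.
case=> ex xe.
have [y [[ey ye] [xyx yxy]]] : exists y, (e * y = y /\ y * e = y) /\
                                         (x * y * x = x /\ y * x * y = y).
  (* As [e] need not be self-adjoint, [x^*] may leave [e S e] and is compressed back into it. *)
  exists (e * x^* * e); split; rewrite !mulA ?ee ?mul_idemr //.
  by rewrite xe !(mul2_prefix ex) mulxVx !(mul2_prefix xe)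
             (mul3_prefix (mulVxV x)).
exists y; split=> [|y' []]; first by split=> //; apply/local_subsemigroupE.
move=> /(local_subsemigroupE ee) [ey' y'e] [xy'x y'xy'].
have xyC : x * y * (x * y') = x * y' * (x * y).
  apply: (C e); rewrite /idempotent_elt ?mulA ?ex ?xyx ?xy'x //.
  - by rewrite -mulA ye.
  - by rewrite -mulA y'e.
have yxC : y * x * (y' * x) = y' * x * (y * x).
  apply: (C e); rewrite /idempotent_elt ?mulA ?yxy ?y'xy' ?ey ?ey' //.
  - by rewrite -mulA xe.
  - by rewrite -mulA xe.
transitivity (y * x * y').
  transitivity (y * (x * y' * (x * y))).
    by rewrite !mulA (mul3_prefix xy'x) yxy.
  by rewrite -xyC !mulA yxy.
transitivity (y * x * (y' * x) * y').
  by rewrite !mulA (mul3_prefix y'xy').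
by rewrite yxC !mulA (mul3_prefix xyx) y'xy'.
Qed.

(** Both [g * h] and [h * g] are inverses of the idempotent [g * h] in [i S i], so uniqueness
    identifies them. *)
Lemma locally_inverse_orthodox_commuting :
  orthodox mul -> locally_inverse mul -> locally_commuting.
Proof.
move=> O L i g h ii gg hh ig gi ih hi.
have [_ /(_ (g * h)) []] := L i ii.
  by apply/local_subsemigroupE => //; rewrite mulA ig -mulA hi.
move=> y [_ uniq_y].
have gh := O _ _ gg hh; have hg := O _ _ hh gg.
transitivity y.
  apply/esym/uniq_y; split; last by split; rewrite !gh.
  by apply/local_subsemigroupE => //; rewrite mulA ig -mulA hi.
apply: uniq_y; split; last split.
- by apply/local_subsemigroupE => //; rewrite mulA ih -mulA gi.
- by rewrite !mulA !mul_idemr // -mulA gh.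
- by rewrite !mulA !mul_idemr // -mulA hg.
Qed.

(** * Necessity of the three conditions *)

Section YangBaxterNecessity.

Hypothesis Y1 : forall x y z, ybe1 x y z.
Hypothesis Y3 : forall x y z, ybe3 x y z.

Lemma square_left_divides x : exists w, x = w * (x * x).
Proof.
(* Read off from [Y1] by taking stars and multiplying by [x] on the right: the word then ends in
   [x^* * (x * x)]. *)
exists (x * x * x * (x * x * x)^* * (x * x^*) * (x * x^*) * x^*).
have : x * x^* * (x^* * x) * (x * x^*) * (x * x^*)
         * (x * x * x * (x * x * x)^*) = x * x^*.
  by rewrite Y1 !idem_mulxV.
move=> /(congr1 (fun y => y^* * x)) E.
transitivity ((x * x^*)^* * x); first by rewrite starM starK mulxVx.
by rewrite -E -[X in _ = _ * (_ * X)]mulxVx !(starM, starK, mulA).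
Qed.

Lemma square_right_divides x : exists w, x = x * x * w.
Proof.
have [w /(congr1 star)] := square_left_divides x^*.
by rewrite !starM !starK; exists w^*.
Qed.

Lemma ybe_completely_regular : completely_regular mul.
Proof.
move=> a; split=> x; split=> [[-> | [s ->]] | [-> | [s ->]]]; right.
- exact: square_left_divides.
- have [w {1}->] := square_left_divides a.
  by exists (s * w); rewrite !mulA.
- by exists a.
- by exists (s * a); rewrite !mulA.
- exact: square_right_divides.
- have [w {1}->] := square_right_divides a.
  by exists (w * s); rewrite !mulA.
- by exists a.
- by exists (a * s); rewrite !mulA.
Qed.

Definition projection e := idem e /\ e^* = e.

Lemma projection_mulxV x : projection (x * x^*).
Proof. by split; [exact: idem_mulxV | rewrite starM starK]. Qed.

Lemma projection_mulVx x : projection (x^* * x).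
Proof. by split; [exact: idem_mulVx | rewrite starM starK]. Qed.

Lemma projection_conj e f : projection e -> projection f -> projection (e * f * e).
Proof.
move=> [ee se] [ff sf]; split; last by rewrite !starM se sf mulA.
have := mulxVx (e * f); rewrite starM se sf !mulA !mul_idemr // => ef.
by rewrite /idempotent_elt !mulA mul_idemr // ef.
Qed.

(** The star of [e * f] is [f * e], so this is the regularity identity at [e * f]. *)
Lemma projection_mul_idem e f : projection e -> projection f -> idem (e * f).
Proof.
move=> [ee se] [ff sf]; have := mulxVx (e * f).
by rewrite starM se sf /idempotent_elt !mulA !mul_idemr.
Qed.

Lemma projection_sandwich e f z : projection e -> projection f ->
  e * z * f = e * f * (e * z * f) * (e * f).
Proof.
move=> pe pf; have [[ee se] [ff sf]] := (pe, pf).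
have ef := projection_mul_idem _ _ pe pf.
have := Y1 e f z; rewrite /ybe1 !starM se sf !mulA ee !mul_idemr //.
by move: ef; rewrite /idempotent_elt !mulA => /mul4_prefix ->; rewrite mulA.
Qed.

Lemma projection_sandwich_l e f z : projection e -> projection f ->
  e * z * f = e * f * e * z * f.
Proof.
move=> pe pf; have aa := projection_mul_idem e f pe pf.
have -> : e * f * e * z * f = e * f * (e * z * f) by rewrite !mulA.
by rewrite projection_sandwich //; move: (e * f) aa => a aa; rewrite !mulA aa.
Qed.

Lemma projection_sandwich_r e f z : projection e -> projection f ->
  e * z * f = e * z * f * e * f.
Proof.
move=> pe pf; have aa := projection_mul_idem e f pe pf.
rewrite -[RHS]mulA projection_sandwich //.
by move: (e * f) aa => a aa; rewrite mul_idemr.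
Qed.

(** The sandwich identity gives [p * q = q * p * q], which is self-adjoint. *)
Lemma projection_mul_comm e p q : projection e -> projection p -> projection q ->
  e * p = p -> e * q = q -> p * q = q * p.
Proof.
move=> pe pp pq ep eq.
have pqE : p * q = q * p * q.
  by have := projection_sandwich_l e q p pe pq; rewrite ep !eq -(mulA q e) ep.
have [[qq sq] [_ sp]] := (pq, pp).
by move: (congr1 star pqE); rewrite !starM sp sq mulA -pqE.
Qed.

(** The third component handles words ending in [f * e]; the sandwich identity appends that ending
    and removes it afterwards. *)
Lemma projection_expand e f x : projection e -> projection f ->
  e * f * x * e = e * f * e * x * e.
Proof.
move=> pe pf; have [[ee se] [ff sf]] := (pe, pf).
have [ef fe] : e * f * e * f = e * f /\ f * e * f * e = f * e.
  have := projection_mul_idem f e pf pe; have := projection_mul_idem e f pe pf.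
  by rewrite /idempotent_elt !mulA.
have E3 y : e * f * y * f * e = e * f * e * y * f * e.
  have := Y3 y f e; rewrite /ybe3 !starM se sf !mulA !mul_idemr // ef => ->.
  by rewrite (mul4_prefix fe) mulA.
have R y u : u * f * y * e = u * f * y * e * f * e.
  have := projection_sandwich_r f e y pf pe.
  by move/(congr1 (mul u)); rewrite !mulA.
have E3' : e * f * x * e * f * e = e * f * e * x * e * f * e.
  by have := E3 (x * e); rewrite !mulA.
by rewrite R E3' -(mulA _ e x) -R !mulA.
Qed.

Lemma ybe_idempotents_commute : locally_commuting.
Proof.
(* The projections [t^* * t] and [t * t^*] commute below [p]; their products in the two orders are
   [t^*] and [t]. *)
have self_adjoint p t : projection p -> idem t -> p * t = t -> t * p = t ->
    t^* = t.
  move=> pp tt pt tp; have [_ sp] := pp.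
  have pt' : p * t^* = t^* by rewrite -{1}sp -starM tp.
  have := projection_mul_comm p (t^* * t) (t * t^*) pp
            (projection_mulVx t) (projection_mulxV t).
  rewrite !mulA pt pt' (mul_idemr tt) mulVxV => -> //.
  by rewrite (mul_idemr (star_idem tt)) mulxVx.
move=> i g h ii gg hh ig gi ih hi.
have pp := projection_mulxV i.
(* Right multiplication by [i^*] carries idempotents of [i S i] to projections below [i * i^*];
   right multiplication by [i] undoes this. *)
have shift t : idem t -> i * t = t -> t * i = t ->
    projection (t * i^*) /\ i * i^* * (t * i^*) = t * i^*.
  move=> tt it ti.
  have pt : i * i^* * (t * i^*) = t * i^* by rewrite -{1}it !mulA mulxVx it.
  have idt : idem (t * i^*).
    by rewrite /idempotent_elt -{2}it !mulA -{1}ti (mul3_prefix (mulxVx i)) ti tt.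
  split=> //; split=> //; apply: (self_adjoint (i * i^*)) => //.
  by rewrite !mulA -{1}ti (mul3_prefix (mulxVx i)) ti.
have [pg ig'] := shift g gg ig gi; have [ph ih'] := shift h hh ih hi.
have unshift s t : i * t = t -> t * i = t -> s * i = s ->
    s * t = s * i^* * (t * i^*) * i.
  move=> it ti si.
  have absorb u : u * i = u -> u * i^* * i = u.
    by move=> ui; rewrite -{1}ui (mul3_prefix (mulxVx i)).
  by rewrite -{2}it !mulA (absorb s si) (mul3_prefix (absorb t ti)).
rewrite (unshift g h) // (unshift h g) //.
by rewrite (projection_mul_comm _ _ _ pp pg ph ig' ih').
Qed.

Lemma idem_projections t :
  idem t -> exists e f, [/\ projection e, projection f & t = e * f].
Proof.
move=> tt; exists (t * t^*), (t^* * t).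
split; [exact: projection_mulxV | exact: projection_mulVx |].
by rewrite mulA (mul_idemr (star_idem tt)) mulxVx.
Qed.

(** A product of two idempotents is a product [e f g h] of projections. It equals [c h], where [c]
    is the product of the commuting projections [e f e], [e g e], [e h e]; since [c h c = c], it is
    idempotent. *)
Lemma ybe_orthodox : orthodox mul.
Proof.
move=> i j /idem_projections [e [f [pe pf ->]]].
move=> /idem_projections [g [h [pg ph ->]]].
have [ee _] := pe.
have cj a : projection a -> projection (e * a * e) by exact: projection_conj.
have comm a b : projection a -> projection b ->
    e * a * e * (e * b * e) = e * b * e * (e * a * e).
  move=> pa pb; apply: (projection_mul_comm e) => //; try exact: cj.
    by rewrite !mulA ee.
  by rewrite !mulA ee.
have [[[F _] [G _]] [H _]] := (cj f pf, cj g pg, cj h ph).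
set w := e * f * (g * h).
have wE : w = w * e * h.
  by have := projection_sandwich_r e h (f * g) pe ph; rewrite /w !mulA.
pose c := e * f * e * (e * g * e) * (e * h * e).
have cE : w * e = c.
  have Pf := projection_expand e f (g * h) pe pf.
  have Pg := projection_expand e g h pe pg.
  rewrite /w /c !mulA in Pf Pg *; rewrite Pf !mul_idemr //.
  by move/(congr1 (mul (e * f))): Pg; rewrite !mulA.
have cc : idem c.
  move: (comm f g pf pg) (comm f h pf ph) (comm g h pg ph) F G H; rewrite /c.
  move: (e * f * e) (e * g * e) (e * h * e) => x y z xy xz yz xx yy zz.
  rewrite /idempotent_elt !mulA -(mulA _ z x) -xz mulA -(mulA _ y x) -xy.
  by rewrite !mulA xx -(mulA _ z y) -yz !mulA !mul_idemr.
have cehe : c * (e * h * e) = c by rewrite /c mul_idemr.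
have ce : c * e = c by rewrite -cE mul_idemr.
have ec : e * c = c by rewrite /c !mulA ee.
rewrite /idempotent_elt wE cE; clearbody c.
(* Between two copies of [c], the factor [h] acts as [e h e], which [c] absorbs. *)
have chc : c * h * c = c.
  transitivity (c * (e * h * e) * c); last by rewrite cehe cc.
  by rewrite !mulA ce (mul2_prefix ec).
by rewrite !mulA chc.
Qed.

End YangBaxterNecessity.

(** * Sufficiency: inserting and erasing idempotents *)

Section YangBaxterSufficiency.

Hypothesis CR : completely_regular mul.
Hypothesis O : orthodox mul.
Hypothesis L : locally_inverse mul.

Let C : locally_commuting := locally_inverse_orthodox_commuting O L.

Lemma completely_regular_square x :
  exists s t, x = x * x * s /\ x = t * (x * x).
Proof.
have [lx rx] := CR x.
have [s xs] : exists s, x = x * x * s.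
  by case: (rx x) => /(_ (or_introl erefl)) [xx | //] _; exists x; rewrite -!xx.
have [t xt] : exists t, x = t * (x * x).
  by case: (lx x) => /(_ (or_introl erefl)) [xx | //] _; exists x; rewrite -!xx.
by exists s, t.
Qed.

(* Green's J-preorder: by complete regularity its quotient is a semilattice in
   which products are meets. *)
Definition below a b := exists s t, a = s * b * t.

Lemma below_refl a : below a a.
Proof. by exists (a * a^*), (a^* * a); rewrite !mulA !mulxVx. Qed.

Lemma below_starl a : below a^* a.
Proof. by exists a^*, a^*; rewrite mulVxV. Qed.

Lemma below_trans a b c : below a b -> below b c -> below a c.
Proof.
by move=> [s [t ->]] [s' [t' ->]]; exists (s * s'), (t' * t); rewrite !mulA.
Qed.

Lemma below_mull a b c : below a b -> below (a * c) b.
Proof. by move=> [s [t ->]]; exists s, (t * c); rewrite !mulA. Qed.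

Lemma below_mulr a b c : below a b -> below (c * a) b.
Proof. by move=> [s [t ->]]; exists (c * s), t; rewrite !mulA. Qed.

Lemma below_square a : below a (a * a).
Proof.
have [_ [t [_ at_]]] := completely_regular_square a.
exists t, (a^* * a).
by rewrite {1}at_ !mulA (mul3_prefix (mulxVx a)).
Qed.

Lemma below_mulC a b : below (a * b) (b * a).
Proof.
apply: below_trans (below_square _) _.
by rewrite !mulA; apply: below_mull; rewrite -mulA; exact/below_mulr/below_refl.
Qed.

(** The square of [a] contains a word [b m c], whose own square contains [c * b]. *)
Lemma below_mul a b c : below a b -> below a c -> below a (b * c).
Proof.
move=> [s [t asbt]] [s' [t' as'ct']].
apply: (@below_trans _ (c * b)); last exact: below_mulC.
apply: below_trans (below_square a) _; rewrite {1}asbt as'ct'.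
apply: (@below_trans _ (b * (t * s') * c)).
  by exists s, t'; rewrite !mulA.
apply: below_trans (below_square _) _.
by exists (b * (t * s')), (t * s' * c); rewrite !mulA.
Qed.

Lemma below_star a b : below a b -> below a b^*.
Proof.
move=> ab; apply: below_trans ab _.
by exists b, b; rewrite mulxVx.
Qed.

(* With [j = a b], the idempotent [k = b a] satisfies [i k = k], and [j k]
   generates the same right ideal as [j] because [b] does so with [b b]. *)
Lemma below_idem_absorb j i : idem j -> idem i -> below j i -> j * i * j = j.
Proof.
move=> jj ii [s [t jE]].
pose a := j * s * i; pose b := i * t * j.
have jjr u : u * j * j = u * j := mul_idemr jj.
have ja : j * a = a by rewrite /a !mulA jj.
have bj : b * j = b by rewrite /b jjr.
have ab : a * b = j.
  by rewrite /a /b !mulA mul_idemr // -(mulA j) -(mulA j) -jE jj.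
have ib : i * b = b by rewrite /b !mulA ii.
clearbody a b.
have [r [t' [br _]]] := completely_regular_square b.
have [k [ik jkbr]] : exists k, i * k = k /\ j * k * (b * r) = j.
  exists (b * a); split; first by rewrite mulA ib.
  have jbr : j * (b * r) = j by rewrite -ab -mulA (mulA b) -br.
  by rewrite !mulA (mul2_prefix ab) (mul2_prefix bj) -mulA.
have jikbr : j * i * (k * (b * r)) = j.
  by rewrite !mulA (mul2_prefix ik) -mulA.
(* [j] is a right multiple of the idempotent [j * i], which therefore fixes it on the left. *)
by rewrite -{2}jikbr mulA (O _ _ jj ii) jikbr.
Qed.

(** Absorption gives [a b a = a] and [b a b = b]; as [a] and [b] commute in [e S e], both equal
    [a * b]. *)
Lemma below_idem_eq a b e : idem e -> idem a -> idem b ->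
  e * a = a -> a * e = a -> e * b = b -> b * e = b ->
  below a b -> below b a -> a = b.
Proof.
move=> ee aa bb ea ae eb be /(below_idem_absorb _ _ aa bb) aba.
move=> /(below_idem_absorb _ _ bb aa) bab.
have ab := C e a b ee aa bb ea ae eb be.
by rewrite -aba ab -(mulA b) aa -{2}bab -ab -mulA bb ab.
Qed.

(** To place a word below a target, the target is split into letters without their stars, and each
    is sought in the word. *)
Ltac below_letter :=
  first [ exact: below_refl
        | exact: below_starl
        | apply: below_mulr; below_letter
        | apply: below_mull; below_letter ].

Ltac below_word :=
  repeat first [ apply: below_mul | apply: below_star ]; below_letter.

(** By [below_idem_eq], [e f e = e i f e] in [e S e] and [f e f = f e i f] in [f S f]. Hence
    [e f = e f e f = e i f e i f = e i f]. *)
Lemma idem_insert_middle e f i : idem e -> idem f -> idem i ->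
  below (e * f) i -> e * i * f = e * f.
Proof.
move=> ee ff ii efi.
have ef := O _ _ ee ff; have fe := O _ _ ff ee.
have ei := O _ _ ee ii; have fi := O _ _ ff ii.
have efe : idem (e * f * e) by apply: O.
have efeE : e * f * e = e * i * f * e.
  apply: (below_idem_eq _ _ e) => //; rewrite ?mulA ?ee ?mul_idemr //.
  - by apply/O/ee/O.
  - apply: below_mul; last by below_word.
    apply: below_mul; last by below_word.
    by apply: below_mul; [below_word | exact: below_mull].
  - by below_word.
have feif : f * e * f = f * e * i * f.
  apply: (below_idem_eq _ _ f) => //; rewrite ?mulA ?ff ?mul_idemr //.
  - by apply/O/ff/O.
  - by apply/O/ff/O.
  - apply: below_mul; last by below_word.
    apply: below_mul; first by below_word.
    by rewrite -mulA; exact: below_mulr.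
  - by below_word.
have eif : idem (e * i * f) by apply: O.
rewrite -[RHS]ef mulA efeE -!mulA (mulA f) feif !mulA.
by rewrite -[LHS]eif !mulA.
Qed.

(** Reduces to the idempotents [u^* * u] and [v * v^*] adjacent to [i]. *)
Lemma idem_insert u v i : idem i -> below (u * v) i -> u * i * v = u * v.
Proof.
move=> ii uvi.
rewrite -{1}(mulxVx u) -{1}(mulxVx v) -(mulA u) !mulA.
have := idem_insert_middle _ _ _ (idem_mulVx u) (idem_mulxV v) ii.
move=> E; transitivity (u * (u^* * u * i * (v * v^*)) * v).
  by rewrite !mulA.
rewrite E; first by rewrite !mulA mulxVx (mul3_prefix (mulxVx v)).
apply: below_trans uvi.
by exists u^*, v^*; rewrite !mulA.
Qed.

Lemma sufficient_ybe1 x y z : ybe1 x y z.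
Proof.
rewrite /ybe1; set q := y * x * y * _.
have qq : idem q := idem_mulxV _.
have qy : q * (y * y^*) = q by rewrite /q !starM !mulA (mul3_prefix (mulVxV y)).
transitivity (x * x^* * (y^* * y) * (x * x^* * z * q)); first by rewrite !mulA.
rewrite idem_insert; [| exact: idem_mulVx | by rewrite /q; below_word].
(* [q] absorbs [y * y^*] on the right; once this factor is exposed, [q] can be erased. *)
transitivity (x * x^* * z * q * (y * y^*)).
  by rewrite -[RHS]mulA qy !mulA mulxVx.
by apply: idem_insert => //; rewrite /q; below_word.
Qed.

Lemma sufficient_ybe2 x y z : ybe2 x y z.
Proof.
rewrite /ybe2; set q := y * x * y * _; set p := y * y^* * z^* * x * _.
have qq : idem q := idem_mulxV _.
have pp : idem (p * p^*) := idem_mulxV _.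
have yq : y * y^* * q = q by rewrite /q !mulA mulxVx.
have yp : y * y^* * (p * p^*) = p * p^* by rewrite /p !mulA mulxVx.
pose w := z^* * y^* * z^*.
transitivity (q * w).
  transitivity (q * z^* * (x * x^*) * (y^* * q * z^*)); first by rewrite !mulA.
  rewrite idem_insert; [| exact: idem_mulxV | by rewrite /q; below_word].
  transitivity (q * z^* * y^* * q * z^*); first by rewrite !mulA.
  rewrite idem_insert //; first by rewrite /w !mulA.
  by rewrite /q; below_word.
(* Next to [y * y^*], which both absorb on the left, [q] is traded for [p * p^*]: insert the latter,
   then erase the former. *)
rewrite -yq -(idem_insert _ w (p * p^*)) //; last by rewrite yq /q /p /w; below_word.
rewrite -[LHS]mulA idem_insert //; first by rewrite mulA yp.
by rewrite /q /p /w; below_word.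
Qed.

Lemma sufficient_ybe3 x y z : ybe3 x y z.
Proof.
rewrite /ybe3.
have zy := idem_mulxV (z * y); have yy := idem_mulxV y; have zz := idem_mulVx z.
rewrite (idem_insert _ (y * z) (z^* * z)) //; last by below_word.
rewrite (idem_insert _ (y * z) (y * y^*)) //; last by below_word.
rewrite -(mulA _ x) (idem_insert (z * y) _ (z * y * (z * y)^*)) //; last by below_word.
by rewrite !mulA.
Qed.

End YangBaxterSufficiency.
Lemma yang_baxter_plusP :
  yang_baxter_solution (associated_map (star_plus mul star) mul star) <->
    completely_regular mul /\ orthodox mul /\ locally_inverse mul.
Proof.
apply: (iff_trans yang_baxter_plusE); split=> [Y | [CR [O L]] x y z]; last first.
  by split; [exact: sufficient_ybe1 | exact: sufficient_ybe2 |
             exact: sufficient_ybe3].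
have Y1 x y z : ybe1 x y z by case: (Y x y z).
have Y3 x y z : ybe3 x y z by case: (Y x y z).
split; first exact: ybe_completely_regular.
split; first exact: ybe_orthodox.
exact/locally_inverse_commuting/ybe_idempotents_commute.
Qed.

End RegularStarSemigroup.

(** * Opposite semigroups and the second operation *)

Definition opposite (S : Type) (mul : S -> S -> S) : S -> S -> S :=
  fun x y => mul y x.

Lemma opposite_regular_star (S : Type) (mul : S -> S -> S) (star : S -> S) :
  regular_star_semigroup mul star ->
  regular_star_semigroup (opposite S mul) star.
Proof.
case=> inhS mulA mulxVx starK starM; split=> //; rewrite /opposite.
- by move=> x y z; rewrite mulA.
- by move=> x; rewrite mulA mulxVx.
- by move=> x y; rewrite starM.
Qed.

Lemma opposite_properties (S : Type) (mul : S -> S -> S) :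
  associative mul ->
  completely_regular mul /\ orthodox mul /\ locally_inverse mul ->
  completely_regular (opposite S mul) /\ orthodox (opposite S mul) /\
    locally_inverse (opposite S mul).
Proof.
move=> mulA [CR [O L]]; split; first by move=> a; case: (CR a).
split=> [e f ee ff | e ee]; first exact: O.
have localE x : local_subsemigroup (opposite S mul) e x <->
    local_subsemigroup mul e x.
  by split=> [] [s ->]; exists s; rewrite /opposite mulA.
have [closed inverse] := L e ee.
split=> [x y /localE ex /localE ey | x /localE /inverse [y]].
  by apply/localE; exact: closed.
move=> [[/localE ey [xyx yxy]] uniq_y]; exists y.
split=> [|y' [/localE ey' [xy'x y'xy']]].
  by split=> //; rewrite /opposite !mulA.
by apply: uniq_y; split=> //; rewrite -!mulA.
Qed.

(** Reversing triples exchanges the two sides of the equation. *)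
Lemma yang_baxter_conj_swap (S : Type) (r r' : S * S -> S * S) :
  (forall a b, r' (a, b) = ((r (b, a)).2, (r (b, a)).1)) ->
  yang_baxter_solution r -> yang_baxter_solution r'.
Proof.
have map_timesE (t : S * S -> S * S) a b c : map_times_id t (a, b, c) =
    ((t (a, b)).1, (t (a, b)).2, c).
  by move=> /=; case: (t _).
have times_mapE (t : S * S -> S * S) a b c : id_times_map t (a, b, c) =
    (a, (t (b, c)).1, (t (b, c)).2).
  by move=> /=; case: (t _).
move=> r'E Y [[x y] z]; move: (Y (z, y, x)).
by rewrite /comp !(map_timesE, times_mapE) !r'E => -[-> -> ->].
Qed.

Theorem proposition4p5 (S : Type) (mul : S -> S -> S) (star : S -> S)
    (hS : regular_star_semigroup mul star) :
  (yang_baxter_solution (associated_map (star_plus mul star) mul star) <->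
     completely_regular mul /\ orthodox mul /\ locally_inverse mul) /\
  (yang_baxter_solution (associated_map (star_oplus mul star) mul star) <->
     completely_regular mul /\ orthodox mul /\ locally_inverse mul).
Proof.
split; first exact: yang_baxter_plusP.
have hop := opposite_regular_star _ _ _ hS.
have [_ mulA _ starK starM] := hS; have [_ mulA' _ _ _] := hop.
pose rp := associated_map (star_plus (opposite S mul) star) (opposite S mul) star.
pose ro := associated_map (star_oplus mul star) mul star.
have roE a b : ro (a, b) = ((rp (b, a)).2, (rp (b, a)).1).
  by rewrite /ro /rp /= /star_oplus /star_plus /opposite !starM !starK.
have rpE a b : rp (a, b) = ((ro (b, a)).2, (ro (b, a)).1).
  by rewrite roE /=.
split=> [Y | P].
  (* The opposite of the opposite is [mul] by conversion. *)
  apply: (opposite_properties _ (opposite S mul)) => //.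
  by apply/(yang_baxter_plusP _ _ _ hop); exact: yang_baxter_conj_swap Y.
apply: yang_baxter_conj_swap roE _; apply/(yang_baxter_plusP _ _ _ hop).
exact: opposite_properties.
Qed.
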